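(* Let $d\in\mathbb{N}$, let $H$ be a Hilbert space, let $\rho:\mathrm{Pol}(U_d^+)\to B(H)$ be a unital $^*$-representation, and let $\eta:\mathrm{Pol}(U_d^+)\to H$ be a $\rho$-$\epsilon$-cocycle. Define $B,\widetilde B\in M_d(\mathbb{C})$ by $$B_{jk}=\sum_{p=1}^d\langle\eta(u_{jp}),\eta(u_{kp})\rangle,\qquad\widetilde B_{jk}=\sum_{p=1}^d\langle\eta(u_{jp}^* ),\eta(u_{kp}^* )\rangle.$$ Then $\eta$ admits a generating functional if and only if $\widetilde B=B^t$.
   Context: $\mathrm{Pol}(U_d^+)$ is the universal unital $^*$-algebra generated by $u_{jk}$, $1\le j,k\le d$, subject to $uu^*=u^*u=I$ and $\bar uu^t=u^t\bar u=I$, where $u=(u_{jk})$, $\bar u=(u_{jk}^* )$, $u^t=(u_{kj})$. Its character $\epsilon$ is the unital $^*$-homomorphism to $\mathbb{C}$ with $\epsilon(u_{jk})=\delta_{jk}$. Inner products are linear in the second argument. A $\rho$-$\epsilon$-cocycle is a linear map $\eta$ with $\eta(ab)=\rho(a)\eta(b)+\eta(a)\epsilon(b)$ for all $a,b$. The cocycle $\eta$ admits a generating functional if there is a linear functional $\psi:\mathrm{Pol}(U_d^+)\to\mathbb{C}$ such that $(\rho,\eta,\psi)$ is a Schürmann triple, i.e. $\psi(ab)=\psi(a)\epsilon(b)+\epsilon(a)\psi(b)+\langle\eta(a^* ),\eta(b)\rangle$ for all $a,b$ (such $\psi$ can then always be replaced by its hermitianisation $\frac12(\psi+\overline{\psi(\,\cdot^*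 )})$, which is normalized, hermitian and conditionally positive). *)

(* Defs.v *)
From HB Require Import structures.
From mathcomp Require Import all_boot all_order all_algebra.
From mathcomp Require Import complex.
From mathcomp Require Import all_classical all_reals all_analysis.

Set Implicit Arguments.
Unset Strict Implicit.
Unset Printing Implicit Defensive.

Import Order.TTheory GRing.Theory Num.Theory.
Import numFieldNormedType.Exports.

Local Open Scope ring_scope.
Local Open Scope quotient_scope.

HB.mixin Record Algebra_isStarAlgebra (C : numClosedFieldType) A
    of GRing.Algebra C A := {
  star : A -> A;
  starK : involutive star;
  starD : {morph star : x y / x + y};
  starZ : forall (c : C) (x : A), star (c *: x) = c^* *: star x;
  starM : forall x y : A, star (x * y) = star y * star x
}.

#[short(type="starAlgType")]
HB.structure Definition StarAlgebra (C : numClosedFieldType) :=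
  {A of GRing.Algebra C A & Algebra_isStarAlgebra C A}.

Lemma conjC_scale (C : numClosedFieldType) (c : C) (x : C^o) :
  (c *: x : C)^* = (c^* *: (x^* : C^o) : C^o).
Proof. exact: rmorphM. Qed.

Lemma conjC_mul (C : numClosedFieldType) (x y : C^o) :
  ((x : C) * y)^* = (y : C)^* * (x : C)^*.
Proof. by rewrite rmorphM mulrC. Qed.

HB.instance Definition _ (C : numClosedFieldType) :=
  Algebra_isStarAlgebra.Build C C^o
    (@conjCK C) (rmorphD (@Num.conj C)) (@conjC_scale C) (@conjC_mul C).

Section StarMatrix.
Variables (C : numClosedFieldType) (A : starAlgType C) (d : nat).

(** The entrywise adjoint of [v]; the adjoint matrix is [(bar_mx v)^T]. *)
Definition bar_mx (v : 'M[A]_d) : 'M[A]_d := map_mx star v.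

Definition biunitary (v : 'M[A]_d) : Prop :=
  [/\ v *m (bar_mx v)^T = 1%:M, (bar_mx v)^T *m v = 1%:M,
      bar_mx v *m v^T = 1%:M & v^T *m bar_mx v = 1%:M].

End StarMatrix.

Section StarAlgebraTheory.
Variables (C : numClosedFieldType) (A : starAlgType C).

Lemma star0 : star (0 : A) = 0.
Proof. by apply: (@addrI _ (star (0 : A))); rewrite -starD !addr0. Qed.

Lemma star1 : star (1 : A) = 1.
Proof.
have e : star (1 * star 1 : A) = star 1 by rewrite starM starK mul1r.
by rewrite -[LHS]e mul1r starK.
Qed.

End StarAlgebraTheory.

Section PolTerms.
Variables (C : numClosedFieldType) (d : nat).

Inductive pterm : Type :=
| Tgen of 'I_d & 'I_d
| Tzero
| Tone
| Tadd of pterm & pterm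
| Tscale of C & pterm
| Tmul of pterm & pterm
| Tstar of pterm.

Definition tsum (f : 'I_d -> pterm) : pterm := \big[Tadd/Tzero]_(p < d) f p.
Definition tdelta (j k : 'I_d) : pterm := if j == k then Tone else Tzero.

(** The least congruence that contains the axioms of unital *-algebras and
    the defining relations of Pol(U_d^+). *)
Inductive pcong : pterm -> pterm -> Prop :=
| pc_refl x : pcong x x
| pc_sym x y : pcong x y -> pcong y x
| pc_trans x y z : pcong x y -> pcong y z -> pcong x z
| pc_add x x' y y' : pcong x x' -> pcong y y' -> pcong (Tadd x y) (Tadd x' y')
| pc_scale c x x' : pcong x x' -> pcong (Tscale c x) (Tscale c x')
| pc_mul x x' y y' : pcong x x' -> pcong y y' -> pcong (Tmul x y) (Tmul x' y')
| pc_star x x' : pcong x x' -> pcong (Tstar x) (Tstar x')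
| pc_addA x y z : pcong (Tadd x (Tadd y z)) (Tadd (Tadd x y) z)
| pc_addC x y : pcong (Tadd x y) (Tadd y x)
| pc_add0 x : pcong (Tadd Tzero x) x
| pc_addN x : pcong (Tadd (Tscale (-1) x) x) Tzero
| pc_scaleA c c' x : pcong (Tscale c (Tscale c' x)) (Tscale (c * c') x)
| pc_scale1 x : pcong (Tscale 1 x) x
| pc_scaleDr c x y :
    pcong (Tscale c (Tadd x y)) (Tadd (Tscale c x) (Tscale c y))
| pc_scaleDl c c' x :
    pcong (Tscale (c + c') x) (Tadd (Tscale c x) (Tscale c' x))
| pc_mulA x y z : pcong (Tmul x (Tmul y z)) (Tmul (Tmul x y) z)
| pc_mul1l x : pcong (Tmul Tone x) x
| pc_mul1r x : pcong (Tmul x Tone) x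
| pc_mulDl x y z : pcong (Tmul (Tadd x y) z) (Tadd (Tmul x z) (Tmul y z))
| pc_mulDr x y z : pcong (Tmul x (Tadd y z)) (Tadd (Tmul x y) (Tmul x z))
| pc_scaleAl c x y : pcong (Tscale c (Tmul x y)) (Tmul (Tscale c x) y)
| pc_scaleAr c x y : pcong (Tscale c (Tmul x y)) (Tmul x (Tscale c y))
| pc_starK x : pcong (Tstar (Tstar x)) x
| pc_starD x y : pcong (Tstar (Tadd x y)) (Tadd (Tstar x) (Tstar y))
| pc_starZ c x : pcong (Tstar (Tscale c x)) (Tscale c^* (Tstar x))
| pc_starM x y : pcong (Tstar (Tmul x y)) (Tmul (Tstar y) (Tstar x))
  (* u u^* = I *)
| pc_rel1 j k :
    pcong (tsum (fun p => Tmul (Tgen j p) (Tstar (Tgen k p)))) (tdelta j k)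
  (* u^* u = I *)
| pc_rel2 j k :
    pcong (tsum (fun p => Tmul (Tstar (Tgen p j)) (Tgen p k))) (tdelta j k)
  (* \bar u u^t = I *)
| pc_rel3 j k :
    pcong (tsum (fun p => Tmul (Tstar (Tgen j p)) (Tgen k p))) (tdelta j k)
  (* u^t \bar u = I *)
| pc_rel4 j k :
    pcong (tsum (fun p => Tmul (Tgen p j) (Tstar (Tgen p k)))) (tdelta j k).

HB.instance Definition _ := gen_eqMixin pterm.
HB.instance Definition _ := gen_choiceMixin pterm.

Definition pcongb (x y : pterm) : bool := `[< pcong x y >].

Lemma pcongb_equiv : equiv_class_of pcongb.
Proof.
split=> [x|x y|y x z]; first exact/asboolP/pc_refl.
- by apply/asboolP/asboolP; exact: pc_sym.
- by move=> /asboolP xy /asboolP yz; apply/asboolP; exact: pc_trans xy yz.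
Qed.

Definition pcong_rel : equiv_rel pterm := EquivRelPack pcongb_equiv.

Definition Pol : Type := {eq_quot pcong_rel}.
HB.instance Definition _ := Choice.on Pol.
HB.instance Definition _ := EqQuotient.on Pol.

Lemma pol_eqP (x y : pterm) : (\pi_Pol x = \pi_Pol y) <-> pcong x y.
Proof.
split; first by move/eqmodP/asboolP.
by move=> xy; apply/eqmodP/asboolP.
Qed.

Lemma pol_reprK (x : pterm) : pcong (repr (\pi_Pol x)) x.
Proof. by apply/pol_eqP; rewrite reprK. Qed.

Definition pol_zero : Pol := \pi_Pol Tzero.
Definition pol_one : Pol := \pi_Pol Tone.
Definition pol_add : Pol -> Pol -> Pol :=
  locked (fun a b => \pi_Pol (Tadd (repr a) (repr b))).
Definition pol_scale : C -> Pol -> Pol :=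
  locked (fun c a => \pi_Pol (Tscale c (repr a))).
Definition pol_mul : Pol -> Pol -> Pol :=
  locked (fun a b => \pi_Pol (Tmul (repr a) (repr b))).
Definition pol_star : Pol -> Pol :=
  locked (fun a => \pi_Pol (Tstar (repr a))).
Definition pol_opp (a : Pol) : Pol := pol_scale (-1) a.

Lemma pol_addE x y : pol_add (\pi_Pol x) (\pi_Pol y) = \pi_Pol (Tadd x y).
Proof. by rewrite /pol_add -lock; apply/pol_eqP/pc_add; exact: pol_reprK. Qed.

Lemma pol_scaleE c x : pol_scale c (\pi_Pol x) = \pi_Pol (Tscale c x).
Proof. by rewrite /pol_scale -lock; apply/pol_eqP/pc_scale; exact: pol_reprK. Qed.

Lemma pol_mulE x y : pol_mul (\pi_Pol x) (\pi_Pol y) = \pi_Pol (Tmul x y).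
Proof. by rewrite /pol_mul -lock; apply/pol_eqP/pc_mul; exact: pol_reprK. Qed.

Lemma pol_starE x : pol_star (\pi_Pol x) = \pi_Pol (Tstar x).
Proof. by rewrite /pol_star -lock; apply/pol_eqP/pc_star; exact: pol_reprK. Qed.

Definition polE := (pol_addE, pol_scaleE, pol_mulE, pol_starE).

Section Eval.
Variables (A : starAlgType C) (v : 'M[A]_d).

Fixpoint teval (x : pterm) : A :=
  match x with
  | Tgen j k => v j k
  | Tzero => 0
  | Tone => 1
  | Tadd x y => teval x + teval y
  | Tscale c x => c *: teval x
  | Tmul x y => teval x * teval y
  | Tstar x => star (teval x)
  end.

Lemma teval_sum f : teval (tsum f) = \sum_(p < d) teval (f p).
Proof. by rewrite /tsum; elim/big_rec2: _ => //= p x y _ <-. Qed.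

Lemma teval_delta j k : teval (tdelta j k) = (j == k)%:R.
Proof. by rewrite /tdelta; case: eqP. Qed.

Lemma teval_cong x y : biunitary v -> pcong x y -> teval x = teval y.
Proof.
move=> [v1 v2 v3 v4]; elim => //=.
- by move=> x1 x2 x3 _ -> _ ->.
- by move=> x1 x2 y1 y2 _ -> _ ->.
- by move=> c x1 x2 _ ->.
- by move=> x1 x2 y1 y2 _ -> _ ->.
- by move=> x1 x2 _ ->.
- by move=> *; rewrite addrA.
- by move=> *; rewrite addrC.
- by move=> *; rewrite add0r.
- by move=> *; rewrite scaleN1r addNr.
- by move=> *; rewrite scalerA.
- by move=> *; rewrite scale1r.
- by move=> *; rewrite scalerDr.
- by move=> *; rewrite scalerDl.
- by move=> *; rewrite mulrA.
- by move=> *; rewrite mul1r.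
- by move=> *; rewrite mulr1.
- by move=> *; rewrite mulrDl.
- by move=> *; rewrite mulrDr.
- by move=> *; rewrite scalerAl.
- by move=> *; rewrite scalerAr.
- by move=> *; rewrite starK.
- by move=> *; rewrite starD.
- by move=> *; rewrite starZ.
- by move=> *; rewrite starM.
- move=> j k; rewrite teval_sum teval_delta.
  move/matrixP/(_ j k): v1; rewrite !mxE => <-.
  by apply: eq_bigr => p _; rewrite !mxE.
- move=> j k; rewrite teval_sum teval_delta.
  move/matrixP/(_ j k): v2; rewrite !mxE => <-.
  by apply: eq_bigr => p _; rewrite !mxE.
- move=> j k; rewrite teval_sum teval_delta.
  move/matrixP/(_ j k): v3; rewrite !mxE => <-.
  by apply: eq_bigr => p _; rewrite !mxE.
- move=> j k; rewrite teval_sum teval_delta.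
  move/matrixP/(_ j k): v4; rewrite !mxE => <-.
  by apply: eq_bigr => p _; rewrite !mxE.
Qed.

Lemma teval_repr x : biunitary v -> teval (repr (\pi_Pol x)) = teval x.
Proof. by move=> vP; apply: teval_cong vP _; exact: pol_reprK. Qed.

End Eval.

Lemma biunitary1 (A : starAlgType C) : biunitary (1%:M : 'M[A]_d).
Proof.
have b1 : bar_mx (1%:M : 'M[A]_d) = 1%:M.
  by apply/matrixP => j k; rewrite !mxE; case: eqP; rewrite ?star1 ?star0.
by split; rewrite b1 trmx1 mulmx1.
Qed.

Lemma pol_addA : associative pol_add.
Proof.
by elim/quotW=> x; elim/quotW=> y; elim/quotW=> z;
  rewrite !polE; apply/pol_eqP; constructor.
Qed.

Lemma pol_addC : commutative pol_add.
Proof.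
by elim/quotW=> x; elim/quotW=> y; rewrite !polE; apply/pol_eqP; constructor.
Qed.

Lemma pol_add0 : left_id pol_zero pol_add.
Proof. by elim/quotW=> x; rewrite !polE; apply/pol_eqP; constructor. Qed.

Lemma pol_addN : left_inverse pol_zero pol_opp pol_add.
Proof.
by elim/quotW=> x; rewrite /pol_opp !polE; apply/pol_eqP; constructor.
Qed.

Lemma pol_mulA : associative pol_mul.
Proof.
by elim/quotW=> x; elim/quotW=> y; elim/quotW=> z;
  rewrite !polE; apply/pol_eqP; constructor.
Qed.

Lemma pol_mul1l : left_id pol_one pol_mul.
Proof. by elim/quotW=> x; rewrite !polE; apply/pol_eqP; constructor. Qed.

Lemma pol_mul1r : right_id pol_one pol_mul.
Proof. by elim/quotW=> x; rewrite !polE; apply/pol_eqP; constructor. Qed.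

Lemma pol_mulDl : left_distributive pol_mul pol_add.
Proof.
by elim/quotW=> x; elim/quotW=> y; elim/quotW=> z;
  rewrite !polE; apply/pol_eqP; constructor.
Qed.

Lemma pol_mulDr : right_distributive pol_mul pol_add.
Proof.
by elim/quotW=> x; elim/quotW=> y; elim/quotW=> z;
  rewrite !polE; apply/pol_eqP; constructor.
Qed.

Lemma pol_one_neq0 : pol_one != pol_zero.
Proof.
apply/eqP => /pol_eqP /(teval_cong (biunitary1 C^o)) /= /eqP.
by rewrite oner_eq0.
Qed.

Lemma pol_scaleA c c' a : pol_scale c (pol_scale c' a) = pol_scale (c * c') a.
Proof.
by elim/quotW: a => x; rewrite !polE; apply/pol_eqP; constructor.
Qed.

Lemma pol_scale1 : left_id 1 pol_scale.
Proof. by elim/quotW=> x; rewrite !polE; apply/pol_eqP; constructor. Qed.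

Lemma pol_scaleDr : right_distributive pol_scale pol_add.
Proof.
by move=> c; elim/quotW=> x; elim/quotW=> y;
  rewrite !polE; apply/pol_eqP; constructor.
Qed.

Lemma pol_scaleDl a :
  {morph pol_scale^~ a : c c' / c + c' >-> pol_add c c'}.
Proof.
by move=> c c'; elim/quotW: a => x; rewrite !polE; apply/pol_eqP; constructor.
Qed.

Lemma pol_scaleAl c a b : pol_scale c (pol_mul a b) = pol_mul (pol_scale c a) b.
Proof.
by elim/quotW: a => x; elim/quotW: b => y;
  rewrite !polE; apply/pol_eqP; constructor.
Qed.

Lemma pol_scaleAr c a b : pol_scale c (pol_mul a b) = pol_mul a (pol_scale c b).
Proof.
by elim/quotW: a => x; elim/quotW: b => y;
  rewrite !polE; apply/pol_eqP; constructor.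
Qed.

HB.instance Definition _ :=
  GRing.isZmodule.Build Pol pol_addA pol_addC pol_add0 pol_addN.
HB.instance Definition _ :=
  GRing.Zmodule_isNzRing.Build Pol
    pol_mulA pol_mul1l pol_mul1r pol_mulDl pol_mulDr pol_one_neq0.
HB.instance Definition _ :=
  GRing.Zmodule_isLmodule.Build C Pol
    pol_scaleA pol_scale1 pol_scaleDr pol_scaleDl.
HB.instance Definition _ := GRing.Lmodule_isLalgebra.Build C Pol pol_scaleAl.
HB.instance Definition _ := GRing.Lalgebra_isAlgebra.Build C Pol pol_scaleAr.

Lemma piD x y : \pi_Pol x + \pi_Pol y = \pi_Pol (Tadd x y).
Proof. exact: pol_addE. Qed.

Lemma piZ c x : c *: \pi_Pol x = \pi_Pol (Tscale c x).
Proof. exact: pol_scaleE. Qed.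

Lemma piM x y : \pi_Pol x * \pi_Pol y = \pi_Pol (Tmul x y).
Proof. exact: pol_mulE. Qed.

Lemma pol_starK : involutive pol_star.
Proof. by elim/quotW=> x; rewrite !polE; apply/pol_eqP; constructor. Qed.

Lemma pol_starD : {morph pol_star : x y / x + y}.
Proof.
by elim/quotW=> x; elim/quotW=> y; rewrite ?(piD, piZ, piM, pol_starE); apply/pol_eqP; constructor.
Qed.

Lemma pol_starZ c (a : Pol) : pol_star (c *: a) = c^* *: pol_star a.
Proof. by elim/quotW: a => x; rewrite ?(piD, piZ, piM, pol_starE); apply/pol_eqP; constructor. Qed.

Lemma pol_starM (a b : Pol) : pol_star (a * b) = pol_star b * pol_star a.
Proof.
by elim/quotW: a => x; elim/quotW: b => y;
  rewrite ?(piD, piZ, piM, pol_starE); apply/pol_eqP; constructor.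
Qed.

HB.instance Definition _ :=
  Algebra_isStarAlgebra.Build C Pol pol_starK pol_starD pol_starZ pol_starM.

Lemma piS x : star (\pi_Pol x) = \pi_Pol (Tstar x).
Proof. exact: pol_starE. Qed.

Definition pol_u : 'M[Pol]_d := \matrix_(j, k) (\pi_Pol (Tgen j k)).

Lemma pi_tsum f : \pi_Pol (tsum f) = \sum_(p < d) \pi_Pol (f p).
Proof.
rewrite /tsum; elim/big_rec2: _ => //= p x y _ <-.
by rewrite piD.
Qed.

Lemma pi_tdelta j k : \pi_Pol (tdelta j k) = (j == k)%:R.
Proof. by rewrite /tdelta; case: eqP. Qed.

Lemma pol_u_biunitary : biunitary pol_u.
Proof.
split; apply/matrixP => j k; rewrite !mxE -pi_tdelta.
- rewrite -(iffRL (pol_eqP _ _) (pc_rel1 j k)) pi_tsum.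
  by apply: eq_bigr => p _; rewrite !mxE piS piM.
- rewrite -(iffRL (pol_eqP _ _) (pc_rel2 j k)) pi_tsum.
  by apply: eq_bigr => p _; rewrite !mxE piS piM.
- rewrite -(iffRL (pol_eqP _ _) (pc_rel3 j k)) pi_tsum.
  by apply: eq_bigr => p _; rewrite !mxE piS piM.
- rewrite -(iffRL (pol_eqP _ _) (pc_rel4 j k)) pi_tsum.
  by apply: eq_bigr => p _; rewrite !mxE piS piM.
Qed.

(** Together with [pol_u_biunitary], the lemmas on [pol_lift] are the universal
    property of [Pol] among unital *-algebras. *)
Section Lift.
Variables (A : starAlgType C) (v : 'M[A]_d) (vP : biunitary v).

Definition pol_lift of biunitary v := fun a : Pol => teval v (repr a).

Local Notation lift := (pol_lift vP).

Lemma pol_lift_is_linear : linear lift.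
Proof.
move=> c; elim/quotW=> x; elim/quotW=> y.
by rewrite piZ piD /pol_lift !teval_repr.
Qed.

Lemma pol_lift_is_monoid_morphism : monoid_morphism lift.
Proof.
split; first by rewrite /pol_lift (teval_repr Tone).
elim/quotW=> x; elim/quotW=> y.
by rewrite piM /pol_lift !teval_repr.
Qed.

HB.instance Definition _ := GRing.isLinear.Build C Pol A *:%R lift
  pol_lift_is_linear.
HB.instance Definition _ := GRing.isMonoidMorphism.Build Pol A lift
  pol_lift_is_monoid_morphism.

Lemma pol_lift_star (a : Pol) : lift (star a) = star (lift a).
Proof.
elim/quotW: a => x.
by rewrite piS /pol_lift !teval_repr.
Qed.

Lemma pol_lift_u j k : lift (pol_u j k) = v j k.
Proof. by rewrite /pol_lift mxE teval_repr. Qed.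

Lemma pol_lift_unique (f : {lrmorphism Pol -> A}) :
  (forall a, f (star a) = star (f a)) ->
  (forall j k, f (pol_u j k) = v j k) -> f =1 lift.
Proof.
move=> fS fu; elim/quotW => x; rewrite /pol_lift teval_repr //.
elim: x => [j k|||x IHx y IHy|c x IHx|x IHx y IHy|x IHx] /=.
- by rewrite -fu mxE.
- exact: (raddf0 f).
- exact: (rmorph1 f).
- by rewrite -IHx -IHy -rmorphD; congr (f _); rewrite piD.
- by rewrite -IHx -linearZ; congr (f _); rewrite piZ.
- by rewrite -IHx -IHy -rmorphM; congr (f _); rewrite piM.
- by rewrite -IHx -fS; congr (f _); rewrite piS.
Qed.

End Lift.

Definition counit : {lrmorphism Pol -> C^o} := pol_lift (biunitary1 C^o).

Lemma counit_u j k : counit (pol_u j k) = (j == k)%:R.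
Proof. by rewrite /counit /= pol_lift_u mxE. Qed.

Lemma counit_star a : counit (star a) = (counit a : C)^*.
Proof. exact: (pol_lift_star (biunitary1 C^o)). Qed.

End PolTerms.

Arguments pol_u {C d}.
Arguments counit {C d}.

(** The inner product is linear in its second argument. Positivity and
    definiteness follow from [inner_norm]. *)
HB.mixin Record CompleteNormedModule_isHilbert (C : numClosedFieldType) H
    of CompleteNormedModule C H := {
  inner : H -> H -> C;
  inner_scalar : forall x : H, scalar (inner x);
  inner_conj : forall x y : H, inner y x = (inner x y)^*;
  inner_norm : forall x : H, inner x x = `|x| ^+ 2
}.

#[short(type="hilbertType")]
HB.structure Definition Hilbert (C : numClosedFieldType) :=
  {H of CompleteNormedModule C H & CompleteNormedModule_isHilbert C H}.

Record bounded_op (C : numClosedFieldType) (H : hilbertType C) := BoundedOp {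
  bounded_op_fun :> {linear H -> H};
  bounded_opP : exists M : C, forall x : H, `|bounded_op_fun x| <= M * `|x|
}.

Definition is_adjoint (C : numClosedFieldType) (H : hilbertType C)
    (S T : bounded_op H) : Prop :=
  forall x y : H, inner (S x) y = inner x (T y).

Record star_representation (C : numClosedFieldType) (A : starAlgType C)
    (H : hilbertType C) (rho : A -> bounded_op H) : Prop := {
  rep_linear : forall (c : C) (a b : A) (x : H),
    rho (c *: a + b) x = c *: rho a x + rho b x;
  rep_one : forall x : H, rho 1 x = x;
  rep_mul : forall (a b : A) (x : H), rho (a * b) x = rho a (rho b x);
  rep_star : forall a : A, is_adjoint (rho (star a)) (rho a)
}.

Section Schuermann.
Variables (C : numClosedFieldType) (d : nat) (H : hilbertType C).
Variable rho : Pol C d -> bounded_op H.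
Variable eta : {linear Pol C d -> H}.

Definition cocycle : Prop :=
  forall a b : Pol C d, eta (a * b) = rho a (eta b) + counit b *: eta a.

Record schuermann_triple (psi : {scalar Pol C d}) : Prop := {
  schuermann_rep : star_representation rho;
  schuermann_cocycle : cocycle;
  schuermann_psi : forall a b : Pol C d,
    psi (a * b)
    = psi a * counit b + counit a * psi b + inner (eta (star a)) (eta b)
}.

(** [psi] is not required to be hermitian: its hermitianisation
    [(psi a + (psi (star a))^* ) / 2] is again part of a Schuermann triple. *)
Definition admits_generating_functional : Prop :=
  exists psi : {scalar Pol C d}, schuermann_triple psi.

Definition Bmat : 'M[C]_d :=
  \matrix_(j, k) \sum_(p < d) inner (eta (pol_u j p)) (eta (pol_u k p)).

Definition Bmat_tilde : 'M[C]_d :=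
  \matrix_(j, k)
    \sum_(p < d) inner (eta (star (pol_u j p))) (eta (star (pol_u k p))).

End Schuermann.

(* Main.v *)
From HB Require Import structures.
Require Import Defs.
From mathcomp Require Import all_boot all_order all_algebra.
From mathcomp Require Import ring.
From mathcomp Require Import complex.
From mathcomp Require Import all_classical all_reals all_analysis.
Import GRing.Theory Num.Theory.
Local Open Scope ring_scope.

(** Applying [psi] to the defining relations of Pol(U_d^+) determines
    [psi (u_jk) + psi (u_kj^* )] in four ways. The two row relations give
    [- Bt_jk] and [- B_kj], so they are compatible iff [Bt = B^T]; the two
    column relations give the same values, because [eta u = - rho(u) eta(u^* )]
    with [rho(u)] unitary. Conversely, the Schuermann identity prescribes a
    hermitian functional on formal *-polynomials by recursion from the values
    [- Bt_jk / 2] on the generators; the cocycle identity makes it compatible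
    with associativity, and the relations above make it descend to Pol(U_d^+). *)

(** * Sesquilinearity of the inner product *)

Section InnerProduct.
Variables (C : numClosedFieldType) (H : hilbertType C).
Implicit Types x y z : H.

HB.instance Definition _ x :=
  GRing.isLinear.Build C H C *%R (inner x) (inner_scalar x).

Lemma innerDr x y z : inner x (y + z) = inner x y + inner x z.
Proof. exact: raddfD. Qed.

Lemma innerZr c x y : inner x (c *: y) = c * inner x y.
Proof. exact: linearZ. Qed.

Lemma innerNr x y : inner x (- y) = - inner x y.
Proof. exact: raddfN. Qed.

Lemma inner0r x : inner x 0 = 0.
Proof. exact: raddf0. Qed.

Lemma inner_sumr n (f : 'I_n -> H) x :
  inner x (\sum_(p < n) f p) = \sum_(p < n) inner x (f p).
Proof. exact: raddf_sum. Qed.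

Lemma innerDl x y z : inner (x + y) z = inner x z + inner y z.
Proof.
by rewrite inner_conj innerDr rmorphD /= -!(inner_conj z).
Qed.

Lemma innerZl c x y : inner (c *: x) y = c^* * inner x y.
Proof. by rewrite inner_conj innerZr rmorphM /= -(inner_conj y). Qed.

Lemma inner0l x : inner 0 x = 0.
Proof. by rewrite inner_conj inner0r rmorph0. Qed.

Lemma innerNl x y : inner (- x) y = - inner x y.
Proof. by rewrite -scaleN1r innerZl rmorphN1 mulN1r. Qed.

Lemma inner_suml n (f : 'I_n -> H) x :
  inner (\sum_(p < n) f p) x = \sum_(p < n) inner (f p) x.
Proof.
rewrite inner_conj inner_sumr rmorph_sum /=.
by apply: eq_bigr => p _; rewrite -inner_conj.
Qed.

End InnerProduct.

(** * The four defining relations, entry by entry *)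

Section Relations.
Variables (C : numClosedFieldType) (d : nat).
Local Notation u := (@pol_u C d).

Lemma sum_u_ustar j k : \sum_p u j p * star (u k p) = (j == k)%:R.
Proof.
have [/matrixP/(_ j k) + _ _ _] := pol_u_biunitary C d; rewrite !mxE => <-.
by apply: eq_bigr => p _; rewrite !mxE.
Qed.

Lemma sum_ustar_u_col j k : \sum_p star (u p j) * u p k = (j == k)%:R.
Proof.
have [_ /matrixP/(_ j k) + _ _] := pol_u_biunitary C d; rewrite !mxE => <-.
by apply: eq_bigr => p _; rewrite !mxE.
Qed.

Lemma sum_ustar_u j k : \sum_p star (u j p) * u k p = (j == k)%:R.
Proof.
have [_ _ /matrixP/(_ j k) + _] := pol_u_biunitary C d; rewrite !mxE => <-.
by apply: eq_bigr => p _; rewrite !mxE.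
Qed.

Lemma sum_u_ustar_col j k : \sum_p u p j * star (u p k) = (j == k)%:R.
Proof.
have [_ _ _ /matrixP/(_ j k) +] := pol_u_biunitary C d; rewrite !mxE => <-.
by apply: eq_bigr => p _; rewrite !mxE.
Qed.

End Relations.

Lemma sum_deltaZ (C : numClosedFieldType) (V : lmodType C) d
    (f : 'I_d -> V) k :
  \sum_(p < d) (k == p)%:R *: f p = f k.
Proof.
rewrite (bigD1 k) //= eqxx scale1r big1 ?addr0 // => p.
by rewrite eq_sym => /negbTE->; rewrite scale0r.
Qed.

Arguments sum_deltaZ {C} V {d}.

(** * Cocycle values on the generators and their Gram sums *)

Section Cocycle.
Variables (C : numClosedFieldType) (d : nat) (H : hilbertType C).
Variables (rho : Pol C d -> bounded_op H) (eta : {linear Pol C d -> H}).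
Hypotheses (rhoP : star_representation rho) (etaP : cocycle rho eta).

Lemma cocycle1 : eta 1 = 0.
Proof.
have := etaP 1 1; rewrite mulr1 rep_one // rmorph1 scale1r.
by move/eqP; rewrite -subr_eq subrr eq_sym => /eqP.
Qed.

Lemma cocycle_delta (j k : 'I_d) : eta (j == k)%:R = 0.
Proof. by case: eqP => _; rewrite ?cocycle1 ?raddf0. Qed.

Lemma rep_delta (j k : 'I_d) x : rho (j == k)%:R x = (j == k)%:R *: x.
Proof.
case: eqP => _; first by rewrite rep_one // scale1r.
(* Writing 0 as (-1) 1 + 1 yields [rho 0 = 0] from linearity. *)
have := rep_linear rhoP (-1) 1 1 x.
by rewrite scaleN1r addNr => ->; rewrite scaleN1r addNr scale0r.
Qed.

Lemma rep_sum n (f : 'I_n -> Pol C d) x :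
  rho (\sum_(p < n) f p) x = \sum_(p < n) rho (f p) x.
Proof.
elim/big_rec2: _ => [|p y a _ <-].
  have := rep_linear rhoP (-1) 1 1 x.
  by rewrite scaleN1r addNr => ->; rewrite scaleN1r addNr.
by rewrite -[f p in LHS]scale1r rep_linear // scale1r.
Qed.

(* [v] stands for [u] or its entrywise adjoint, [w] for the entrywise adjoint
   of [v]. *)
Lemma cocycle_gram (v w : 'I_d -> 'I_d -> Pol C d) :
    (forall j k, w j k = star (v j k)) ->
    (forall j k, counit (w j k) = (j == k)%:R) ->
    (forall j k, \sum_p v j p * w k p = (j == k)%:R) ->
    (forall j k, \sum_p w p j * v p k = (j == k)%:R) ->
  forall k l, \sum_j inner (eta (v j k)) (eta (v j l))
              = \sum_p inner (eta (w k p)) (eta (w l p)).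
Proof.
move=> wE wc vw wv k l.
(* Apply [eta] to row relation [vw]: the counit of [w] is a delta, which isolates one value of [eta]
   on [v]. *)
have eta_v j k' : eta (v j k') = - \sum_p rho (v j p) (eta (w k' p)).
  have := cocycle_delta j k'; rewrite -vw raddf_sum /=.
  under eq_bigr do rewrite etaP wc.
  by rewrite big_split /= sum_deltaZ => /eqP; rewrite addrC addr_eq0 => /eqP.
under eq_bigr => j _.
  rewrite !eta_v innerNl innerNr opprK inner_suml.
  under eq_bigr => p _.
    rewrite inner_sumr.
    under eq_bigr => q _.
      (* The adjoint of [rho (v j p)] is [rho (w j p)]; moved to the right argument it forms the
         product [w j p * v j q]. *)
      rewrite -[v j p]starK rep_star // -wE -rep_mul //.
      over.
    over.
  over.
(* With the sum over [j] innermost, column relation [wv] leaves only [q = p]. *)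
rewrite exchange_big /=; apply: eq_bigr => p _.
rewrite exchange_big /=.
under eq_bigr do rewrite -inner_sumr -rep_sum wv rep_delta innerZr.
by rewrite (sum_deltaZ C^o).
Qed.

End Cocycle.

Arguments cocycle1 {C d H rho eta}.
Arguments cocycle_gram {C d H rho eta}.

(** This is the Schuermann identity summed over a defining relation: the counits of both factors are
    deltas, so one value of [psi] survives on each side, next to a Gram sum [X]. *)
Lemma sum_delta_cross (C : numClosedFieldType) d (P Q X : 'I_d -> C)
    (j k : 'I_d) :
  \sum_p (P p * (k == p)%:R + (j == p)%:R * Q p + X p)
  = P k + Q j + \sum_p X p.
Proof.
rewrite !big_split /= (sum_deltaZ C^o); congr (_ + _ + _).
by under eq_bigr do rewrite mulrC; exact: (sum_deltaZ C^o).
Qed.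

Arguments sum_delta_cross {C d}.

Lemma counit_ustar (C : numClosedFieldType) d (j k : 'I_d) :
  counit (star (@pol_u C d j k)) = (j == k)%:R.
Proof. by rewrite counit_star counit_u conjC_nat. Qed.

(** * The counit as a scalar-valued character *)

Section Counit.
Variables (C : numClosedFieldType) (d : nat).
Implicit Types a b : Pol C d.

(* [counit] takes values in [C^o]; the constant hides this from [ring]. *)
Definition counitC a : C := counit a.

Lemma counitC1 : counitC 1 = 1.
Proof. exact: rmorph1. Qed.

Lemma counitCD a b : counitC (a + b) = counitC a + counitC b.
Proof. exact: rmorphD. Qed.

Lemma counitCM a b : counitC (a * b) = counitC a * counitC b.
Proof. exact: rmorphM. Qed.

Lemma counitCZ c a : counitC (c *: a) = c * counitC a.
Proof. by rewrite /counitC linearZ. Qed.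

Lemma counitC_star a : counitC (star a) = (counitC a)^*.
Proof. exact: counit_star. Qed.

Lemma counitC_u j k : counitC (pol_u j k) = (j == k)%:R.
Proof. exact: counit_u. Qed.

Lemma counitC_ustar j k : counitC (star (pol_u j k)) = (j == k)%:R.
Proof. exact: counit_ustar. Qed.

End Counit.

Arguments counitC {C d}.

(** * Necessity: a generating functional forces the matrix identity *)

Section Necessity.
Variables (C : numClosedFieldType) (d : nat) (H : hilbertType C).
Variables (rho : Pol C d -> bounded_op H) (eta : {linear Pol C d -> H}).
Variable psi : {scalar Pol C d}.
Hypothesis tripleP : schuermann_triple rho eta psi.
Local Notation u := (@pol_u C d).

Lemma triple1 : psi 1 = 0.
Proof.
have [rhoP etaP psiP] := tripleP.
have := psiP 1 1; rewrite !mulr1 rmorph1 mulr1 mul1r (cocycle1 rhoP etaP).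
rewrite inner0r addr0.
by move/eqP; rewrite -subr_eq subrr eq_sym => /eqP.
Qed.

Lemma triple_delta (j k : 'I_d) : psi (j == k)%:R = 0.
Proof. by case: eqP => _; rewrite ?triple1 ?raddf0. Qed.

Lemma triple_Bmat_tilde : Bmat_tilde eta = (Bmat eta)^T.
Proof.
have [rhoP etaP psiP] := tripleP.
apply/matrixP => j k.
(* Entry (j,k) of u u^* = I. *)
have e1 : psi (u j k) + psi (star (u k j)) + Bmat_tilde eta j k = 0.
  rewrite [Bmat_tilde _ _ _]mxE; apply: etrans (triple_delta j k).
  rewrite -sum_u_ustar raddf_sum /=.
  under [RHS]eq_bigr do rewrite psiP counit_u counit_ustar.
  exact/esym/(sum_delta_cross (fun p => psi (u j p))
    (fun p => psi (star (u k p)))).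
(* Entry (k,j) of \bar u u^t = I; the indices are swapped so that the same two values of [psi] occur
   as in [e1]. *)
have e2 : psi (star (u k j)) + psi (u j k) + Bmat eta k j = 0.
  rewrite [Bmat _ _ _]mxE; apply: etrans (triple_delta k j).
  rewrite -sum_ustar_u raddf_sum /=.
  under [RHS]eq_bigr do rewrite psiP counit_u counit_ustar starK.
  exact/esym/(sum_delta_cross (fun p => psi (star (u k p)))
    (fun p => psi (u j p))).
move: e1; rewrite -e2 [psi (u j k) + _]addrC => /addrI ->.
by rewrite [RHS]mxE.
Qed.

End Necessity.

(** * Sufficiency: a functional on formal terms *)

Section Sufficiency.
Variables (C : numClosedFieldType) (d : nat) (H : hilbertType C).
Variables (rho : Pol C d -> bounded_op H) (eta : {linear Pol C d -> H}).
Hypotheses (rhoP : star_representation rho) (etaP : cocycle rho eta).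
Hypothesis BtE : Bmat_tilde eta = (Bmat eta)^T.
Local Notation u := (@pol_u C d).
Local Notation cls := (\pi_(Pol C d))%qT.

(** Since [counit] and [eta] already live on the quotient, the [Tmul] clause evaluates them on
    classes. As [Bmat_tilde eta] is hermitian, u_jk and u_kj^* receive the same value, half of what
    the relations prescribe for their sum. *)
Fixpoint tpsi (x : pterm C d) : C :=
  match x with
  | Tgen j k => - (Bmat_tilde eta j k / 2)
  | Tzero => 0
  | Tone => 0
  | Tadd x y => tpsi x + tpsi y
  | Tscale c x => c * tpsi x
  | Tmul x y => tpsi x * counitC (cls y) + counitC (cls x) * tpsi y
                + inner (eta (star (cls x))) (eta (cls y))
  | Tstar x => (tpsi x)^*
  end.

Lemma tpsi_sum f : tpsi (tsum f) = \sum_(p < d) tpsi (f p).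
Proof. by rewrite /tsum; elim/big_rec2: _ => //= p x y _ <-. Qed.

Lemma tpsi_delta (j k : 'I_d) : tpsi (tdelta C j k) = 0.
Proof. by rewrite /tdelta; case: eqP. Qed.

Lemma Bmat_tilde_conj j k : (Bmat_tilde eta j k)^* = Bmat_tilde eta k j.
Proof.
rewrite !mxE rmorph_sum /=.
by apply: eq_bigr => p _; rewrite -inner_conj.
Qed.

Lemma half_conj j k : (Bmat_tilde eta j k / 2)^* = Bmat_tilde eta k j / 2.
Proof. by rewrite rmorphM /= Bmat_tilde_conj fmorphV /= conjC_nat. Qed.

Lemma half_half (x : C) : - (x / 2) - x / 2 + x = 0.
Proof. by rewrite -opprD -splitr addNr. Qed.

Lemma cls_gen j k : cls (Tgen C j k) = u j k.
Proof. by rewrite mxE. Qed.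

(** Induction on the derivation of the congruence, one case per axiom or relation. *)
Lemma tpsi_cong x y : pcong x y -> tpsi x = tpsi y.
Proof.
have counitE (a : Pol C d) : counit a = counitC a by [].
have clsE z t : pcong z t -> cls z = cls t by move/pol_eqP.
elim => //=.
- by move=> x1 x2 x3 _ -> _ ->.
- by move=> x1 x2 y1 y2 _ -> _ ->.
- by move=> c x1 x2 _ ->.
- by move=> x1 x2 y1 y2 /clsE -> -> /clsE -> ->.
- by move=> x1 x2 _ ->.
- by move=> *; rewrite addrA.
- by move=> *; rewrite addrC.
- by move=> *; rewrite add0r.
- by move=> *; rewrite mulN1r addNr.
- by move=> *; rewrite mulrA.
- by move=> *; rewrite mul1r.
- by move=> *; rewrite mulrDr.
- by move=> *; rewrite mulrDl.
(* Associativity: both inner products expand by the cocycle identity, and the two terms containing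
   [rho] agree because [rho] respects adjoints. *)
- move=> x1 x2 x3; rewrite -!piM starM !etaP !counitE !counitCM.
  rewrite counitC_star innerDr innerDl innerZr innerZl conjCK rep_star //.
  ring.
- move=> x1; rewrite counitC1 star1 (cocycle1 rhoP etaP).
  by rewrite inner0l mul0r mul1r add0r addr0.
- move=> x1; rewrite counitC1 (cocycle1 rhoP etaP).
  by rewrite inner0r mulr0 mulr1 !addr0.
- move=> x1 x2 x3; rewrite -piD starD counitCD (raddfD eta) innerDl.
  ring.
- move=> x1 x2 x3; rewrite -piD counitCD (raddfD eta) innerDr.
  ring.
- move=> c x1 x2; rewrite -piZ starZ counitCZ [eta (_ *: _)]linearZ innerZl.
  rewrite conjCK.
  ring.
- move=> c x1 x2; rewrite -piZ counitCZ [eta (_ *: _)]linearZ innerZr.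
  ring.
- by move=> x1; rewrite conjCK.
- by move=> x1 x2; rewrite rmorphD.
- by move=> c x1; rewrite rmorphM.
- move=> x1 x2; rewrite -!piS !counitC_star starK 2!rmorphD !rmorphM /=.
  rewrite -inner_conj.
  ring.
(* u u^* = I: the Gram sum is an entry of [Bmat_tilde] by definition. *)
- move=> j k; rewrite tpsi_sum tpsi_delta.
  under eq_bigr => p _.
    rewrite [tpsi _]/= -piS !cls_gen counitC_u counitC_ustar.
    over.
  rewrite (sum_delta_cross (fun p => tpsi (Tgen C j p))
    (fun p => tpsi (Tstar (Tgen C k p)))) /=.
  rewrite rmorphN /= half_conj.
  have -> : \sum_p inner (eta (star (u j p))) (eta (star (u k p)))
      = Bmat_tilde eta j k by rewrite [RHS]mxE.
  exact: half_half.
(* u^* u = I: [cocycle_gram] with v = u turns the column sum into the row sum of the previous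
   case. *)
- move=> j k; rewrite tpsi_sum tpsi_delta.
  under eq_bigr => p _.
    rewrite [tpsi _]/= -!piS !cls_gen counitC_u counitC_ustar starK.
    rewrite [p == k]eq_sym [p == j]eq_sym.
    over.
  rewrite (sum_delta_cross (fun p => tpsi (Tstar (Tgen C p j)))
    (fun p => tpsi (Tgen C p k))) /=.
  rewrite rmorphN /= half_conj.
  have -> : \sum_p inner (eta (u p j)) (eta (u p k)) = Bmat_tilde eta j k.
    rewrite [RHS]mxE.
    apply: (cocycle_gram rhoP etaP u
      (fun a b => star (u a b))) => // a b.
    + exact: counit_ustar.
    + exact: sum_u_ustar.
    + exact: sum_ustar_u_col.
  exact: half_half.
(* \bar u u^t = I: the Gram sum is an entry of [Bmat], converted by [BtE]. *)
- move=> j k; rewrite tpsi_sum tpsi_delta.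
  under eq_bigr => p _.
    rewrite [tpsi _]/= -!piS !cls_gen counitC_u counitC_ustar starK.
    over.
  rewrite (sum_delta_cross (fun p => tpsi (Tstar (Tgen C j p)))
    (fun p => tpsi (Tgen C k p))) /=.
  rewrite rmorphN /= half_conj.
  have -> : \sum_p inner (eta (u j p)) (eta (u k p)) = Bmat_tilde eta k j.
    by rewrite BtE [RHS]mxE [RHS]mxE.
  exact: half_half.
(* u^t \bar u = I: [cocycle_gram] with v = \bar u reduces to an entry of [Bmat], and [BtE] applies
   again. *)
- move=> j k; rewrite tpsi_sum tpsi_delta.
  under eq_bigr => p _.
    rewrite [tpsi _]/= -!piS !cls_gen counitC_u counitC_ustar.
    rewrite [p == k]eq_sym [p == j]eq_sym.
    over.
  rewrite (sum_delta_cross (fun p => tpsi (Tgen C p j))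
    (fun p => tpsi (Tstar (Tgen C p k)))) /=.
  rewrite rmorphN /= half_conj.
  have -> : \sum_p inner (eta (star (u p j))) (eta (star (u p k)))
      = Bmat_tilde eta k j.
    rewrite BtE [RHS]mxE [RHS]mxE.
    apply: (cocycle_gram rhoP etaP
      (fun a b => star (u a b)) u) => a b.
    + by rewrite starK.
    + exact: counit_u.
    + exact: sum_ustar_u.
    + exact: sum_u_ustar_col.
  exact: half_half.
Qed.

(** * Descent to the quotient *)

Definition psi_of (a : Pol C d) : C := tpsi (repr a).

Lemma psi_of_cls x : psi_of (cls x) = tpsi x.
Proof. by apply: tpsi_cong; exact: pol_reprK. Qed.

Lemma psi_of_scalar : scalar psi_of.
Proof.
move=> c; elim/quotW=> x; elim/quotW=> y.
by rewrite piZ piD !psi_of_cls.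
Qed.

HB.instance Definition _ :=
  GRing.isLinear.Build C (Pol C d) C *%R psi_of psi_of_scalar.

Lemma triple_psi_of : schuermann_triple rho eta psi_of.
Proof.
split=> //; elim/quotW=> x; elim/quotW=> y.
(* The [Tmul] clause of [tpsi] is the Schuermann identity itself. *)
rewrite piM; apply: etrans (psi_of_cls _) _ => /=.
by rewrite -(psi_of_cls x) -(psi_of_cls y).
Qed.

End Sufficiency.

Theorem theorem3p3 (R : realType) (d : nat) (H : hilbertType R[i])
    (rho : Pol R[i] d -> bounded_op H) (eta : {linear Pol R[i] d -> H})
    (rhoP : star_representation rho) (etaP : cocycle rho eta) :
  admits_generating_functional rho eta <-> Bmat_tilde eta = (Bmat eta)^T.
Proof.
split=> [[psi]|BtE]; first exact: triple_Bmat_tilde.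
by eexists; exact: triple_psi_of.
Qed.
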